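(* Let $f$ be a field of characteristic $0$, let $L$ be a Lie algebra over $f$, and let $T$ be a strictly triangular representation of $L$ in a finite dimensional $f$-space $E$ with linearly ordered basis $(e_i)_{i\in I}$. Then every orbit of $\Gamma(T)$ in $E$ has a unique lowest point with respect to $\prec$, i.e. a point $x$ of the orbit such that $x\prec y$ for every $y\in\Gamma(T)x$ with $y\neq x$.
   Context: For $x\in E$ write $x=\sum_{i\in I}x_ie_i$. The representation $T$ is called strictly triangular (with respect to the linearly ordered basis $(e_i)_{i\in I}$) if for all $l\in L$ the matrix of $T(l)$ in this basis is strictly lower triangular, i.e. $T(l)e_i$ is a linear combination of the $e_j$ with $j>i$. $\Gamma(T)$ denotes the group of automorphisms of $E$ of the form $\exp T(l)=\sum_{i\ge 0}\frac{1}{i!}T(l)^i$ with $l\in L$. The quasi-ordering $\preceq$ on $E$ is defined by: $x\preceq y$ iff for every $j\in I$ with $x_j\neq 0$ and $y_j=0$ there exists $i\le j$ with $x_i=0$ and $y_i\neq 0$. Write $x\prec y$ iff $x\preceq y$ and $y\not\preceq x$. *)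

(* Defs.v *)
From HB Require Import structures.
From mathcomp Require Import all_boot all_order all_algebra.

Set Implicit Arguments.
Unset Strict Implicit.
Unset Printing Implicit Defensive.

Import Order.TTheory GRing.Theory Num.Theory.

Local Open Scope ring_scope.

(* The underlying space may be infinite dimensional. *)
HB.mixin Record Lmodule_isLieAlgebra (F : fieldType) L of GRing.Lmodule F L := {
  lie : L -> L -> L;
  lie_is_linearl : forall y, linear (lie^~ y);
  lie_is_linearr : forall x, linear (lie x);
  liexx : forall x, lie x x = 0;
  lie_jacobi : forall x y z,
    lie x (lie y z) + lie y (lie z x) + lie z (lie x y) = 0
}.

#[short(type="lieAlgType")]
HB.structure Definition LieAlgebra (F : fieldType) :=
  {L of Lmodule_isLieAlgebra F L & GRing.Lmodule F L}.

Definition is_lie_representation (F : fieldType) (L : lieAlgType F)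
    (E : vectType F) (T : {linear L -> 'End(E)}) : Prop :=
  forall x y, T (lie x y) = (T x \o T y)%VF - (T y \o T x)%VF.

(* coord e j (u e`_i) is the entry in row j, column i of the matrix of u acting
   on column vectors. *)
Definition strictly_lower_triangular (F : fieldType) (E : vectType F) (n : nat)
    (e : n.-tuple E) (u : 'End(E)) : Prop :=
  forall i j : 'I_n, coord e j (u e`_i) != 0 -> (i < j)%N.

Definition strictly_triangular (F : fieldType) (L : lieAlgType F)
    (E : vectType F) (n : nat) (e : n.-tuple E)
    (T : {linear L -> 'End(E)}) : Prop :=
  forall l, strictly_lower_triangular e (T l).

(* 'End(E) has no canonical ring structure, since E may be trivial. *)
Definition lfun_pow (F : fieldType) (E : vectType F) (u : 'End(E)) (k : nat) :
    'End(E) :=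
  iter k (fun v => (u \o v)%VF) \1%VF.

(* The exponential series of a nilpotent endomorphism: its terms of index at
   least \dim E vanish. *)
Definition lfun_exp (F : fieldType) (E : vectType F) (u : 'End(E)) : 'End(E) :=
  \sum_(k < \dim {:E}) (k`!%:R)^-1 *: lfun_pow u k.

Definition Gamma (F : fieldType) (L : lieAlgType F) (E : vectType F)
    (T : {linear L -> 'End(E)}) (g : 'End(E)) : Prop :=
  exists l : L, g = lfun_exp (T l).

Definition Gamma_orbit (F : fieldType) (L : lieAlgType F) (E : vectType F)
    (T : {linear L -> 'End(E)}) (x y : E) : Prop :=
  exists2 g : 'End(E), Gamma T g & y = g x.

Definition preceq (F : fieldType) (E : vectType F) (n : nat) (e : n.-tuple E)
    (x y : E) : Prop :=
  forall j : 'I_n, coord e j x != 0 -> coord e j y = 0 ->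
  exists i : 'I_n, [/\ (i <= j)%N, coord e i x = 0 & coord e i y != 0].

Definition prec (F : fieldType) (E : vectType F) (n : nat) (e : n.-tuple E)
    (x y : E) : Prop :=
  preceq e x y /\ ~ preceq e y x.

Lemma lfun_pow_strictly_lower_triangular (F : fieldType) (E : vectType F)
    (n : nat) (e : n.-tuple E) (u : 'End(E)) (k : nat) :
  basis_of fullv e -> strictly_lower_triangular e u -> (n <= k)%N ->
  lfun_pow u k = 0.
Proof.
move=> be ut.
have low m v (j : 'I_n) : coord e j (lfun_pow u m v) != 0 -> (m <= j)%N.
  elim: m j => // m IHm j.
  rewrite /= comp_lfunE [lfun_pow u m v](coord_basis be (memvf _)).
  rewrite !linear_sum /= => s_neq0.
  have [i] : exists i : 'I_n,
      (coord e i (lfun_pow u m v) != 0) && (coord e j (u e`_i) != 0).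
    apply/existsP; apply: contraR s_neq0 => /existsPn h; apply/eqP/big1 => i _.
    rewrite !linearZ /=; apply/eqP; rewrite mulf_eq0.
    by have := h i; rewrite negb_and !negbK.
  by case/andP => /IHm mi /ut; apply: leq_ltn_trans.
move=> nk; apply/lfunP => v; rewrite lfunE [LHS](coord_basis be (memvf _)).
apply: big1 => j _; have [->|/low kj] := eqVneq (coord e j (lfun_pow u k v)) 0.
  by rewrite scale0r.
by have := leq_trans (ltn_ord j) (leq_trans nk kj); rewrite ltnn.
Qed.

Lemma lfun_exp_strictly_lower_triangular (F : fieldType) (E : vectType F)
    (n : nat) (e : n.-tuple E) (u : 'End(E)) (N : nat) :
  basis_of fullv e -> strictly_lower_triangular e u -> (n <= N)%N ->
  lfun_exp u = \sum_(k < N) (k`!%:R)^-1 *: lfun_pow u k.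
Proof.
move=> be ut nN; have dE : \dim {:E} = n by rewrite -(size_basis be).
rewrite /lfun_exp dE (big_ord_widen _ (fun k => (k`!%:R)^-1 *: lfun_pow u k) nN).
rewrite big_mkcond /=; apply: eq_bigr => k _; case: ltnP => // nk.
by rewrite (lfun_pow_strictly_lower_triangular be ut nk) scaler0.
Qed.

(* Main.v *)
(* Exponentials of a Lie algebra N of strictly triangular matrices are closed
   under product: for A, B in N there is a matrix X(t) of polynomials with
   exp X(t) = exp(A) exp(tB) and X(0) = A.  Differentiating gives
   X' + (iterated brackets of X' with X) = B, which shows by induction on the
   degree that all the coefficients of X lie in N; then exp(A) exp(B) =
   exp(X(1)) with X(1) in N.  So the orbits of Gamma(T) are those of a group.

   Let E_j be the span of the e_i with i >= j.  The elements l with T(l)x in E_j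
   are those for which exp(T(l)) fixes x modulo E_j, and then exp(T(l)) adds
   (T(l)x)_j to the coordinate x_j.  Hence x can be modified inside its orbit so
   that, for j = 0, 1, ..., either no such l moves x_j or x_j = 0.  A point with
   this property is lowest: at the first coordinate where another point of the
   orbit differs from it, it is zero.  *)
Require Import Defs.
From Stdlib Require Import Classical.
From HB Require Import structures.
From mathcomp Require Import all_boot all_order all_algebra.

Set Implicit Arguments.
Unset Strict Implicit.
Unset Printing Implicit Defensive.

Import Order.TTheory GRing.Theory Num.Theory.

Local Open Scope ring_scope.

(** * The exponential of strictly triangular matrices *)

(** Matrices here are transposed, see [endomx], so what remains lies on or above the k-th
    superdiagonal. This filtration acts as a topology: its steps from [d] on are zero. *)
Definition subdiag (R : nzRingType) (d k : nat) (X : 'M[R]_d) : Prop :=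
  forall i j : 'I_d, (j < i + k)%N -> X i j = 0.

Lemma subdiag0 (R : nzRingType) d k : subdiag k (0 : 'M[R]_d).
Proof. by move=> i j _; rewrite mxE. Qed.

Lemma subdiagD (R : nzRingType) d k (X Y : 'M[R]_d) :
  subdiag k X -> subdiag k Y -> subdiag k (X + Y).
Proof. by move=> hX hY i j ij; rewrite mxE hX ?hY ?addr0. Qed.

Lemma subdiagN (R : nzRingType) d k (X : 'M[R]_d) :
  subdiag k X -> subdiag k (- X).
Proof. by move=> hX i j ij; rewrite mxE hX ?oppr0. Qed.

Lemma subdiagB (R : nzRingType) d k (X Y : 'M[R]_d) :
  subdiag k X -> subdiag k Y -> subdiag k (X - Y).
Proof. by move=> hX hY; apply/subdiagD/subdiagN. Qed.

Lemma subdiagZ (R : nzRingType) d k c (X : 'M[R]_d) :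
  subdiag k X -> subdiag k (c *: X).
Proof. by move=> hX i j ij; rewrite mxE hX ?mulr0. Qed.

Lemma subdiag_sum (R : nzRingType) d k (I : Type) (r : seq I) (P : pred I)
    (X : I -> 'M[R]_d) :
  (forall i, P i -> subdiag k (X i)) -> subdiag k (\sum_(i <- r | P i) X i).
Proof.
by move=> hX; elim/big_ind: _ => //; [apply: subdiag0|apply: subdiagD].
Qed.

Lemma subdiag_leq (R : nzRingType) d k l (X : 'M[R]_d) :
  (l <= k)%N -> subdiag k X -> subdiag l X.
Proof.
by move=> lk hX i j ij; apply/hX/(leq_trans ij); rewrite leq_add2l.
Qed.

Lemma subdiagM (R : nzRingType) d k l (X Y : 'M[R]_d) :
  subdiag k X -> subdiag l Y -> subdiag (k + l) (X *m Y).
Proof.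
move=> hX hY i j ij; rewrite mxE big1 // => m _.
have [mi|im] := ltnP m (i + k); first by rewrite hX ?mul0r.
by rewrite hY ?mulr0 // (leq_trans ij) // addnA leq_add2r.
Qed.

Lemma subdiag_eq0 (R : nzRingType) d k (X : 'M[R]_d) :
  (d <= k)%N -> subdiag k X -> X = 0.
Proof.
move=> dk hX; apply/matrixP => i j; rewrite mxE hX //.
by rewrite (leq_trans (ltn_ord j)) // (leq_trans dk) ?leq_addl.
Qed.

Lemma subdiagX (R : nzRingType) d k (X : 'M[R]_d.+1) :
  subdiag 1 X -> subdiag k (X ^+ k).
Proof.
move=> hX; elim: k => [|k IHk]; last by rewrite exprS; apply: (subdiagM hX).
by move=> i j; rewrite addn0 mxE -val_eqE => ij; rewrite gtn_eqF.
Qed.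

(* The omitted terms vanish when X is strictly triangular, i.e. subdiag 1 X. *)
Definition mxexp (K : comUnitRingType) (d : nat) (X : 'M[K]_d.+1) :=
  \sum_(k < d.+1) (k`!%:R)^-1 *: X ^+ k.

Definition rbracket (K : comUnitRingType) (d : nat) (X Y : 'M[K]_d.+1) :=
  Y * X - X * Y.

(* The series (exp b - 1) / b at b = rbracket X, so that
   (exp X)' = exp X * dexp X X'. *)
Definition dexp (K : comUnitRingType) (d : nat) (X Y : 'M[K]_d.+1) :=
  \sum_(k < d.+1) (k.+1`!%:R)^-1 *: iter k (rbracket X) Y.

Section Exponential.

Variables (K : comUnitRingType) (d : nat).
Hypothesis natr_unit : forall k, k.+1%:R \is a @GRing.unit K.
Implicit Types X Y Z : 'M[K]_d.+1.

Lemma fact_unit k : k`!%:R \is a @GRing.unit K.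
Proof. by have := natr_unit k`!.-1; rewrite prednK ?fact_gt0. Qed.

Lemma invf_factD i j :
  ((i + j)`!%:R)^-1 * 'C(i + j, j)%:R = (i`!%:R)^-1 * (j`!%:R)^-1 :> K.
Proof.
have := bin_fact (leq_addl i j); rewrite addnK => E.
apply: (mulrI (fact_unit (i + j))); rewrite mulrA mulrV ?fact_unit // mul1r.
rewrite -E !natrM [X in _ = _ * _ * X]mulrC -mulrA.
by rewrite mulrACA !divrr ?fact_unit ?mulr1.
Qed.

Lemma mxexp_widen N X : subdiag 1 X -> (d < N)%N ->
  mxexp X = \sum_(k < N) (k`!%:R)^-1 *: X ^+ k.
Proof.
move=> hX dN; rewrite /mxexp.
rewrite (big_ord_widen _ (fun k => (k`!%:R)^-1 *: X ^+ k) dN).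
rewrite big_mkcond /=; apply: eq_bigr => k _; case: ltnP => // dk.
by rewrite (subdiag_eq0 dk (subdiagX hX)) scaler0.
Qed.

Lemma mxexpE X : mxexp X = 1 + \sum_(k < d) (k.+1`!%:R)^-1 *: X ^+ k.+1.
Proof. by rewrite /mxexp big_ord_recl fact0 invr1 scale1r. Qed.

Lemma subdiag_mxexp X : subdiag 1 X -> subdiag 1 (mxexp X - 1).
Proof.
move=> hX; rewrite mxexpE addrC addKr; apply: subdiag_sum => k _.
by apply/subdiagZ/subdiag_leq/subdiagX.
Qed.

(** [mxexp X] is 1 plus a strictly triangular matrix, so [Y = - ((mxexp X - 1) * Y)] pushes Y one
    step further in the filtration each time. *)
Lemma mulr_mxexp_eq0 X Y :
  subdiag 1 X -> subdiag 0 Y -> mxexp X * Y = 0 -> Y = 0.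
Proof.
move=> hX hY XY0; suff hYk k : subdiag k Y by apply: (subdiag_eq0 (leqnn _)).
elim: k => [//|k IHk]; have -> : Y = - ((mxexp X - 1) * Y).
  by rewrite mulrBl XY0 mul1r sub0r opprK.
exact/subdiagN/(subdiagM (subdiag_mxexp hX)).
Qed.

Lemma subdiag_iter_rbracket k m X Y :
  subdiag 1 X -> subdiag m Y -> subdiag (k + m) (iter k (rbracket X) Y).
Proof.
move=> hX hY; elim: k => // k IHk; rewrite iterS; apply: subdiagB.
  by have := subdiagM IHk hX; rewrite addn1.
by apply: (@subdiagM _ _ 1).
Qed.

(** In the higher powers of [X + Y], every term containing Y has another strictly triangular factor.
    To first order, a correction of the exponent thus changes the exponential by itself. *)
Lemma mxexpDl k X Y : subdiag 1 X -> subdiag k.+1 Y ->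
  subdiag k.+2 (mxexp (X + Y) - mxexp X - Y).
Proof.
move=> hX hY; pose W := X + Y.
have hW : subdiag 1 W by apply/subdiagD/subdiag_leq/hY.
have pow m : subdiag (k + m).+1 (W ^+ m.+1 - X ^+ m.+1).
  elim: m => [|m IHm]; first by rewrite !expr1 addn0 addrC addKr.
  have -> : W ^+ m.+2 - X ^+ m.+2 = W * (W ^+ m.+1 - X ^+ m.+1) + Y * X ^+ m.+1.
    have -> : Y = W - X by rewrite /W addrC addKr.
    by rewrite mulrBr mulrBl -!exprS addrA subrK.
  apply: subdiagD; first by rewrite addnS; apply: (@subdiagM _ _ 1).
  exact: (@subdiagM _ _ k.+1 m.+1 Y (X ^+ m.+1) hY (subdiagX hX)).
rewrite -/W (@mxexp_widen d.+2 W) // (@mxexp_widen d.+2 X) // -sumrB.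
rewrite 2!big_ord_recl !fact0 subrr add0r /= !expr1 invr1 !scale1r.
rewrite [W - X]addrC addKr [Y + _]addrC addrK; apply: subdiag_sum => i _.
rewrite -scalerBr; apply/subdiagZ/subdiag_leq/pow.
by rewrite /bump !add1n /= !addnS !ltnS leq_addr.
Qed.

Lemma mxexp_comm X Y : X * Y = Y * X -> mxexp X * Y = Y * mxexp X.
Proof.
move=> XY; rewrite mulr_suml mulr_sumr; apply: eq_bigr => k _.
by rewrite -scalerAl -scalerAr commrX.
Qed.

End Exponential.

(** * The derivative of the exponential *)

(** Reordering for a Cauchy product: the triangle and the square give the same sum because [h]
    vanishes on their difference. *)
Lemma sum_antidiagonal (V : zmodType) (N : nat) (h : nat -> nat -> V) :
  (forall i k, (N <= i + k)%N -> h i k = 0) ->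
  \sum_(m < N) \sum_(k < m.+1) h (m - k)%N k = \sum_(i < N) \sum_(k < N) h i k.
Proof.
move=> h0; rewrite [RHS]exchange_big /=.
under eq_bigr => m _.
  rewrite (big_ord_widen _ (fun k => h (m - k)%N k) (ltn_ord m)); over.
rewrite (exchange_big_dep xpredT) //=; apply: eq_bigr => k _.
have kN : (k <= N)%N by rewrite ltnW.
rewrite -(big_mkord (fun m => (k < m.+1)%N) (fun m => h (m - k)%N k)).
rewrite -(big_mkord xpredT (fun i => h i k)).
rewrite (big_cat_nat (leq0n k) kN) //= big_nat_cond big1 ?add0r; last first.
  by move=> m /andP[/andP[_ mk]]; rewrite ltnS leqNgt mk.
rewrite -{1}[k : nat]add0n big_addn big_mkcond /=.
rewrite (big_cat_nat (leq0n (N - k)) (leq_subr k N)) //=.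
rewrite [LHS in _ = _ + LHS]big_nat_cond.
rewrite [LHS in _ = _ + LHS]big1 ?addr0; last first.
  by move=> i /andP[/andP[Ni _] _]; rewrite h0 // addnC -leq_subLR.
by apply: eq_bigr => i _; rewrite ltnS leq_addl addnK.
Qed.

Lemma map_mxexp (K K' : comUnitRingType) (f : {rmorphism K -> K'}) (d : nat)
    (X : 'M[K]_d.+1) :
  (forall k, k.+1%:R \is a @GRing.unit K) ->
  map_mx f (mxexp X) = mxexp (map_mx f X).
Proof.
move=> nK; rewrite /mxexp rmorph_sum /=; apply: eq_bigr => k _.
by rewrite map_mxZ rmorphXn /= rmorphV ?fact_unit // rmorph_nat.
Qed.

Section Derivative.

Variables (F : fieldType) (d : nat).
Hypothesis char0 : [pchar F] =i pred0.
Implicit Types X Y Z : 'M[{poly F}]_d.+1.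

Lemma natr_unit_field k : k.+1%:R \is a @GRing.unit F.
Proof. by rewrite unitfE ((pcharf0P _).1 char0). Qed.

Lemma natr_unit_poly k : k.+1%:R \is a @GRing.unit {poly F}.
Proof. by rewrite -(rmorph_nat polyC) rmorph_unit ?natr_unit_field. Qed.

Local Notation dmx := (map_mx (@deriv F)).

Lemma deriv_mxM X Y : dmx (X * Y) = dmx X * Y + X * dmx Y.
Proof.
apply/matrixP => i j; rewrite !mxE raddf_sum -big_split /=.
by apply: eq_bigr => k _; rewrite derivM !mxE.
Qed.

Lemma deriv_mxV k X :
  dmx ((k`!%:R)^-1 *: X) = (k`!%:R)^-1 *: dmx X.
Proof.
have -> : (k`!%:R)^-1 = ((k`!%:R)^-1)%:P :> {poly F}.
  by rewrite rmorphV ?rmorph_nat // fact_unit // => m; apply: natr_unit_field.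
by apply/matrixP => i j; rewrite !mxE mul_polyC derivZ -mul_polyC.
Qed.

(** X and its derivative need not commute: [D * X = X * D + rbracket X D] moves the derivative to
    the right, and Pascal's rule collects the coefficients. *)
Lemma deriv_mxX m X : dmx (X ^+ m) =
  \sum_(k < m)
    'C(m, k.+1)%:R *: (X ^+ (m - k.+1) * iter k (rbracket X) (dmx X)).
Proof.
elim: m => [|m IHm].
  rewrite big_ord0 expr0; apply/matrixP => i j.
  by rewrite !mxE derivMn derivC mul0rn.
rewrite exprSr deriv_mxM IHm mulr_suml.
under [RHS]eq_bigr => k _ do rewrite subSS binS natrD scalerDl.
rewrite big_split /= big_ord_recr /= bin_small // scale0r addr0.
rewrite [LHS in _ = _ + LHS]big_ord_recl /= bin0 subn0 scale1r.
rewrite [LHS in _ = _ + LHS]addrC addrA -big_split /=; congr (_ + _).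
apply: eq_bigr => k _; rewrite /bump add1n /=.
set D := iter k _ _; rewrite -scalerAl -scalerDr; congr (_ *: _).
have -> : (m - k = (m - k.+1).+1)%N by rewrite subnSK.
by rewrite exprSr /rbracket mulrBr -!mulrA addrC subrK.
Qed.

Lemma subdiag_deriv k X : subdiag k X -> subdiag k (dmx X).
Proof. by move=> hX i j ij; rewrite mxE hX ?linear0. Qed.

Lemma deriv_mxexp X : subdiag 1 X ->
  dmx (mxexp X) = mxexp X * dexp X (dmx X).
Proof.
(* One term more than in [mxexp]: the constant term has derivative 0, which leaves [d.+1] terms. *)
move=> hX; rewrite [in LHS](@mxexp_widen _ _ d.+2) //.
rewrite raddf_sum big_ord_recl /= deriv_mxV.
rewrite [dmx (X ^+ 0)]deriv_mxX big_ord0 scaler0 add0r.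
pose h i k :=
  (i`!%:R)^-1 *: X ^+ i * ((k.+1`!%:R)^-1 *: iter k (rbracket X) (dmx X)).
transitivity (\sum_(m < d.+1) \sum_(k < m.+1) h (m - k)%N k).
  apply: eq_bigr => m _; rewrite deriv_mxV deriv_mxX scaler_sumr.
  apply: eq_bigr => k _; rewrite /h -scalerAl -scalerAr !scalerA.
  rewrite -invf_factD; last exact: natr_unit_poly.
  by rewrite addnS subnK -1?ltnS // /bump add1n subSS.
rewrite sum_antidiagonal => [|i k dik].
  by rewrite /mxexp mulr_suml; apply: eq_bigr => i _; rewrite mulr_sumr.
apply: (subdiag_eq0 (k := i + (k + 0))); first by rewrite addn0.
apply: subdiagM; first exact/subdiagZ/subdiagX.
exact/subdiagZ/subdiag_iter_rbracket/subdiag_leq/subdiag_deriv/hX.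
Qed.

End Derivative.

(** * Products of exponentials *)

Definition coefmx (F : fieldType) (d : nat) (i : nat) (X : 'M[{poly F}]_d) :
  'M[F]_d := \matrix_(a, b) (X a b)`_i.

Section Product.

Variables (F : fieldType) (d : nat).
Hypothesis char0 : [pchar F] =i pred0.
Implicit Types (A B C : 'M[F]_d.+1) (X Y Z : 'M[{poly F}]_d.+1).

Local Notation dmx := (map_mx (@deriv F)).
Local Notation cst := (map_mx polyC).

Let natrF := natr_unit_field char0.
Let natrP := natr_unit_poly char0.

Lemma coefmxD i X Y : coefmx i (X + Y) = coefmx i X + coefmx i Y.
Proof. by apply/matrixP => a b; rewrite !mxE coefD. Qed.

Lemma coefmxB i X Y : coefmx i (X - Y) = coefmx i X - coefmx i Y.
Proof. by apply/matrixP => a b; rewrite !mxE coefB. Qed.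

Lemma coefmxM i X Y :
  coefmx i (X * Y) = \sum_(j < i.+1) coefmx j X * coefmx (i - j) Y.
Proof.
apply/matrixP => a b; rewrite !mxE coef_sum summxE.
under eq_bigr => k _ do rewrite coefM.
rewrite exchange_big /=; apply: eq_bigr => j _; rewrite mxE.
by apply: eq_bigr => k _; rewrite !mxE.
Qed.

Lemma coefmx0E X : coefmx 0 X = map_mx (horner_eval 0) X.
Proof. by apply/matrixP => a b; rewrite !mxE horner_evalE horner_coef0. Qed.

Lemma coefmx_cst i A : coefmx i (cst A) = if i == 0%N then A else 0.
Proof.
by apply/matrixP => a b; rewrite !mxE coefC; case: ifP; rewrite ?mxE.
Qed.

Lemma coefmx_deriv i X : coefmx i (dmx X) = i.+1%:R *: coefmx i.+1 X.
Proof. by apply/matrixP => a b; rewrite !mxE coef_deriv mulr_natl. Qed.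

Lemma subdiag_cst k A : subdiag k A -> subdiag k (cst A).
Proof. by move=> hA i j ij; rewrite mxE hA. Qed.

(* Successive approximation along the filtration by subdiagonals, correcting Y by
   X - exp Y at each step. *)
Lemma mxexp_surjective A X :
    subdiag 1 A -> subdiag 1 (X - 1) -> mxexp A = coefmx 0 X ->
  exists Y, [/\ subdiag 1 Y, coefmx 0 Y = A & mxexp Y = X].
Proof.
move=> hA hX AX.
suff /(_ d) [Y [hY Y0 /(subdiag_eq0 (leqnn _))/subr0_eq YX]] : forall k,
    exists Y, [/\ subdiag 1 Y, coefmx 0 Y = A & subdiag k.+1 (X - mxexp Y)].
  by exists Y.
elim=> [|k [Y [hY Y0 hD]]].
  exists (cst A); split; [exact: subdiag_cst|by rewrite coefmx_cst|].
  rewrite -(subrK 1 X) -addrA; apply: subdiagD => //.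
  rewrite -opprB; apply/subdiagN/subdiag_mxexp; exact: subdiag_cst.
exists (Y + (X - mxexp Y)); split.
- by apply: subdiagD => //; apply: subdiag_leq hD.
- rewrite coefmxD coefmxB Y0 -AX [coefmx 0 (mxexp Y)]coefmx0E.
  by rewrite (map_mxexp _ _ natrP) -coefmx0E Y0 subrr addr0.
- have := subdiagN (mxexpDl hY hD).
  by rewrite !opprB addrA addrNK.
Qed.

Lemma dexp_comm X Y : Y * X = X * Y -> dexp X Y = Y.
Proof.
move=> XY; have r0 k : iter k.+1 (rbracket X) Y = 0.
  elim: k => [|k IHk]; first by rewrite /= /rbracket XY subrr.
  by rewrite iterS IHk /rbracket mul0r mulr0 subrr.
rewrite /dexp big_ord_recl big1 => [|k _]; last by rewrite r0 scaler0.
by rewrite invr1 scale1r addr0.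
Qed.

Definition line A : 'M[{poly F}]_d.+1 := 'X *: cst A.

Lemma subdiag_line A : subdiag 1 A -> subdiag 1 (line A).
Proof. by move=> hA; apply/subdiagZ/subdiag_cst. Qed.

Lemma horner_line c A : map_mx (horner_eval c) (line A) = c *: A.
Proof.
by apply/matrixP => a b; rewrite !mxE horner_evalE hornerM hornerX hornerC.
Qed.

Lemma horner_cst c A : map_mx (horner_eval c) (cst A) = A.
Proof. by apply/matrixP => a b; rewrite !mxE horner_evalE hornerC. Qed.

Lemma horner_mxexp_line c A :
  map_mx (horner_eval c) (mxexp (line A)) = mxexp (c *: A).
Proof. by rewrite (map_mxexp _ _ natrP) horner_line. Qed.

Lemma mxexp0 : mxexp 0 = 1 :> 'M[F]_d.+1.
Proof.
rewrite mxexpE big1 ?addr0 // => k _.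
by rewrite exprS mul0r scaler0.
Qed.

Lemma line_cst_comm A : cst A * line A = line A * cst A.
Proof. by rewrite -scalerAl -scalerAr. Qed.

Lemma deriv_mxexp_line A : subdiag 1 A ->
  dmx (mxexp (line A)) = mxexp (line A) * cst A.
Proof.
move=> hA; rewrite (deriv_mxexp char0 (subdiag_line hA)).
have -> : dmx (line A) = cst A.
  by apply/matrixP => a b; rewrite !mxE derivM derivX derivC mul1r mulr0 addr0.
by rewrite dexp_comm // line_cst_comm.
Qed.

(** In characteristic 0 a polynomial with zero derivative is constant. *)
Lemma deriv_mx_eq0 X : dmx X = 0 ->
  map_mx (horner_eval 1) X = map_mx (horner_eval 0) X.
Proof.
move=> X0; apply/matrixP => a b; rewrite !mxE !horner_evalE.
suff -> : X a b = ((X a b)`_0)%:P by rewrite !hornerC.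
apply/polyP => -[|i]; rewrite coefC //=.
have /matrixP/(_ a b) := X0; rewrite !mxE => /(congr1 (coefp i)) /=.
rewrite coef_deriv coef0 -mulr_natl => /eqP.
by rewrite mulf_eq0 -[_ == 0 :> F]negbK -unitfE natrF => /eqP.
Qed.

(** The derivative of exp(-tA) exp(tA) is 0; compare the values at t = 1 and t = 0. *)
Lemma mxexpNK A : subdiag 1 A -> mxexp (- A) * mxexp A = 1.
Proof.
move=> hA; have hA' := subdiagN hA.
pose P := mxexp (line (- A)) * mxexp (line A).
have /deriv_mx_eq0 : dmx P = 0.
  rewrite deriv_mxM !deriv_mxexp_line // [mxexp (line A) * _]mxexp_comm.
    by rewrite -mulrA -mulrDr -mulrDl map_mxN addNr mul0r mulr0.
  by rewrite line_cst_comm.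
by rewrite !rmorphM /= !horner_mxexp_line !scale1r !scale0r mxexp0 mul1r.
Qed.

Lemma coefmxV i k X :
  coefmx i ((k`!%:R)^-1 *: X) = (k`!%:R)^-1 *: coefmx i X.
Proof.
have -> : (k`!%:R)^-1 = ((k`!%:R)^-1)%:P :> {poly F}.
  by rewrite rmorphV ?rmorph_nat // fact_unit.
by apply/matrixP => a b; rewrite !mxE mul_polyC coefZ.
Qed.

(** Each term contains a bracket with X. For strictly triangular X this raises the filtration
    degree, so [dexp X] is the identity plus a contraction. *)
Definition dexp_tail X Y :=
  \sum_(k < d) (k.+2`!%:R)^-1 *: iter k.+1 (rbracket X) Y.

Lemma dexpE X Y : dexp X Y = Y + dexp_tail X Y.
Proof. by rewrite /dexp big_ord_recl /= invr1 scale1r. Qed.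

Lemma dexp_tailB X Y Z : dexp_tail X (Y - Z) = dexp_tail X Y - dexp_tail X Z.
Proof.
rewrite -sumrB; apply: eq_bigr => k _; rewrite -scalerBr; congr (_ *: _).
elim: k.+1 => // m IHm; rewrite !iterS IHm /rbracket mulrBl mulrBr.
by rewrite !opprB addrACA [RHS]addrACA; congr (_ + _); rewrite addrC.
Qed.

Lemma subdiag_dexp_tail k X Y :
  subdiag 1 X -> subdiag k Y -> subdiag k.+1 (dexp_tail X Y).
Proof.
move=> hX hY; apply: subdiag_sum => m _; apply/subdiagZ.
apply: (@subdiag_leq _ _ (m.+1 + k)); first by rewrite addSn ltnS leq_addl.
exact: subdiag_iter_rbracket.
Qed.

(** * Coefficients in a Lie algebra of strictly triangular matrices *)

Section LieClosed.

Variable N : 'M[F]_d.+1 -> Prop.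
Hypothesis ND : forall A B, N A -> N B -> N (A + B).
Hypothesis NZ : forall c A, N A -> N (c *: A).
Hypothesis N_lie : forall A B, N A -> N B -> N (A * B - B * A).
Hypothesis N_subdiag : forall A, N A -> subdiag 1 A.
Hypothesis N0 : N 0.

Lemma lie_closed_sum I (r : seq I) (A : I -> 'M[F]_d.+1) :
  (forall i, N (A i)) -> N (\sum_(i <- r) A i).
Proof. by move=> NA; elim/big_ind: _. Qed.

Definition coefs_in k X := forall i, (i <= k)%N -> N (coefmx i X).

Lemma coefs_in_rbracket k X Z :
  coefs_in k X -> coefs_in k Z -> coefs_in k (rbracket X Z).
Proof.
move=> NX NZ' i ik; rewrite coefmxB !coefmxM.
(* Reversing the second convolution pairs Z_j X_(i-j) with X_(i-j) Z_j, so that a sum of commutators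
   appears. *)
rewrite [X in _ - X](reindex_inj rev_ord_inj) /= -sumrB.
apply: lie_closed_sum => j; rewrite subSS subKn -1?ltnS //.
by apply: N_lie; [apply: NZ'|apply: NX]; apply: leq_trans ik;
   rewrite ?leq_subr // -ltnS.
Qed.

Lemma coefs_in_dexp_tail k X Y :
  coefs_in k X -> coefs_in k Y -> coefs_in k (dexp_tail X Y).
Proof.
move=> NX NY i ik.
have -> : coefmx i (dexp_tail X Y) =
    \sum_(k < d) coefmx i ((k.+2`!%:R)^-1 *: iter k.+1 (rbracket X) Y).
  apply/matrixP => a b; rewrite mxE !summxE coef_sum.
  by apply: eq_bigr => m _; rewrite [RHS]mxE.
apply: lie_closed_sum => m; rewrite coefmxV; apply: NZ.
suff : coefs_in k (iter m.+1 (rbracket X) Y) by apply.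
by elim: m.+1 => // l IHl; rewrite iterS; apply: coefs_in_rbracket.
Qed.

(* Y = B - dexp_tail X Y, and iterating this equation from 0 converges to Y along
   the filtration by subdiagonals. *)
Lemma coefs_in_dexp k X Y B : N B -> subdiag 1 X -> subdiag 0 Y ->
  dexp X Y = cst B -> coefs_in k X -> coefs_in k Y.
Proof.
move=> NB hX hY; rewrite dexpE => YB NX.
suff /(_ d.+1) [Z NZ' /(subdiag_eq0 (leqnn _))/subr0_eq->//] :
  forall j, exists2 Z, coefs_in k Z & subdiag j (Y - Z).
elim=> [|j [Z NZ' hYZ]].
  exists 0 => [i _|]; last by rewrite subr0.
  rewrite [coefmx _ _](_ : _ = 0) //.
  by apply/matrixP => a b; rewrite !mxE coef0.
exists (cst B - dexp_tail X Z).
  move=> i ik; rewrite coefmxB coefmx_cst -scaleN1r.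
  by apply: ND; [case: ifP|apply/NZ/(coefs_in_dexp_tail NX NZ')].
have -> : Y - (cst B - dexp_tail X Z) = - dexp_tail X (Y - Z).
  by rewrite -YB dexp_tailB -addrA opprD addrA subrr add0r.
exact/subdiagN/subdiag_dexp_tail.
Qed.

Lemma coefs_in_horner X : (forall i, N (coefmx i X)) ->
  N (map_mx (horner_eval 1) X).
Proof.
move=> NX; pose m := \max_a \max_b size (X a b).
have -> : map_mx (horner_eval 1) X = \sum_(i < m) coefmx i X.
  apply/matrixP => a b; rewrite mxE summxE horner_evalE (@horner_coef_wide _ m).
    by apply: eq_bigr => i _; rewrite mxE expr1n mulr1.
  apply: (leq_trans (leq_bigmax (F := fun b => size (X a b)) b)).
  exact: (leq_bigmax (F := fun a => \max_b size (X a b)) a).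
exact: lie_closed_sum.
Qed.

(** A qualitative Baker-Campbell-Hausdorff theorem: the logarithm of the product lies in [N], with
    no explicit series. *)
Lemma mxexp_mul_closed A B : N A -> N B ->
  exists2 C, N C & mxexp C = mxexp A * mxexp B.
Proof.
move=> NA NB; have [hA hB] := (N_subdiag NA, N_subdiag NB).
pose G := cst (mxexp A) * mxexp (line B).
have hG : subdiag 1 (G - 1).
  have hP : subdiag 1 (cst (mxexp A) - 1).
    have -> : cst (mxexp A) - 1 = cst (mxexp A - 1).
      by rewrite rmorphB /= rmorph1.
    exact/subdiag_cst/subdiag_mxexp.
  have hQ := subdiag_mxexp (subdiag_line hB).
  have -> : G - 1 = (cst (mxexp A) - 1) * (mxexp (line B) - 1)
                    + ((cst (mxexp A) - 1) + (mxexp (line B) - 1)).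
    by rewrite mulrBr mulr1 [RHS]addrA addrNK mulrBl mul1r [RHS]addrA addrNK.
  apply: subdiagD; last exact: subdiagD.
  exact/(subdiag_leq _ (subdiagM hP hQ)).
have [|X [hX X0 XG]] := @mxexp_surjective A G hA hG.
  rewrite coefmx0E rmorphM /= horner_cst horner_mxexp_line.
  by rewrite scale0r mxexp0 mulr1.
(* Both sides agree after multiplication by [mxexp X] = [G], since G' = G B; then [mxexp X] is
   cancelled. *)
have dX : dexp X (dmx X) = cst B.
  apply/subr0_eq/(mulr_mxexp_eq0 hX).
    apply: subdiagB; last exact/subdiag_cst/subdiag_leq/hB.
    rewrite dexpE; apply: subdiagD.
      exact/subdiag_leq/subdiag_deriv/hX.
    apply/(@subdiag_leq _ _ 1) => //; apply: subdiag_dexp_tail => //.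
    exact/subdiag_leq/subdiag_deriv/hX.
  rewrite mulrBr -(deriv_mxexp char0 hX) XG deriv_mxM deriv_mxexp_line //.
  have -> : dmx (cst (mxexp A)) = 0.
    by apply/matrixP => a b; rewrite !mxE derivC.
  by rewrite mul0r add0r mulrA subrr.
(* Coefficient k of X' is k+1 times coefficient k+1 of X, so the differential equation gains one
   degree at a time. *)
have NX k : coefs_in k X.
  elim: k => [|k IHk] i; first by rewrite leqn0 => /eqP ->; rewrite X0.
  rewrite leq_eqVlt => /predU1P[->|]; last by rewrite ltnS => /IHk.
  have hdX : subdiag 0 (dmx X) by apply/subdiag_leq/subdiag_deriv/hX.
  have := coefs_in_dexp NB hX hdX dX IHk (leqnn k).
  rewrite coefmx_deriv => /(NZ (k.+1%:R)^-1).
  by rewrite scalerA mulVr ?scale1r.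
exists (map_mx (horner_eval 1) X).
  by apply: coefs_in_horner => i; apply: (NX i).
rewrite -(map_mxexp _ _ natrP) XG rmorphM /= horner_cst horner_mxexp_line.
by rewrite scale1r.
Qed.

End LieClosed.
End Product.

(** * Orbits and lowest points *)

(* Row i lists the coordinates of u e_i, so that composition becomes the
   reversed matrix product. *)
Definition endomx (F : fieldType) (E : vectType F) (n : nat) (e : n.-tuple E)
  (u : 'End(E)) : 'M[F]_n := \matrix_(i, j) coord e j (u e`_i).

Lemma endomx_linear (F : fieldType) (E : vectType F) (n : nat)
    (e : n.-tuple E) :
  linear (endomx e).
Proof.
by move=> c u v; apply/matrixP => i j; rewrite !mxE !lfun_simp linearP.
Qed.

HB.instance Definition _ (F : fieldType) (E : vectType F) (n : nat)
    (e : n.-tuple E) :=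
  GRing.isSemilinear.Build F 'End(E) 'M[F]_n _ (endomx e)
    (GRing.semilinear_linear (endomx_linear e)).

(** * Endomorphisms as matrices in a basis *)

Section Transfer.

Variables (F : fieldType) (E : vectType F) (n : nat) (e : n.-tuple E).
Hypothesis e_basis : basis_of fullv e.
Implicit Types u v : 'End(E).

Lemma coord_inj x y : (forall i, coord e i x = coord e i y) -> x = y.
Proof.
move=> xy; rewrite (coord_basis e_basis (memvf x)).
rewrite (coord_basis e_basis (memvf y)).
by apply: eq_bigr => i _; rewrite xy.
Qed.

Lemma endomx_inj : injective (endomx e).
Proof.
move=> u v /matrixP uv; apply/lfunP => x.
rewrite (coord_basis e_basis (memvf x)) !linear_sum; apply: eq_bigr => i _.
rewrite !linearZ; congr (_ *: _); apply: coord_inj => j.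
by have := uv i j; rewrite !mxE.
Qed.

Lemma endomx1 : endomx e \1%VF = 1%:M.
Proof.
by apply/matrixP => i j; rewrite !mxE lfunE coord_free ?(basis_free e_basis).
Qed.

Lemma endomx_comp u v : endomx e (u \o v)%VF = endomx e v *m endomx e u.
Proof.
apply/matrixP => i j; rewrite !mxE comp_lfunE.
rewrite {1}(coord_basis e_basis (memvf (v e`_i))) !linear_sum.
by apply: eq_bigr => k _; rewrite !linearZ !mxE.
Qed.

Lemma subdiag_endomx u :
  strictly_lower_triangular e u -> subdiag 1 (endomx e u).
Proof.
move=> hu i j ij; rewrite mxE; apply/eqP; apply: contraLR ij => /hu.
by rewrite -leqNgt addn1.
Qed.

End Transfer.

Lemma endomx_lfun_exp (F : fieldType) (E : vectType F) (d : nat)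
    (e : d.+1.-tuple E) (u : 'End(E)) :
  basis_of fullv e -> endomx e (lfun_exp u) = mxexp (endomx e u).
Proof.
move=> e_basis.
have dE : \dim {:E} = d.+1 by rewrite -(size_basis e_basis).
rewrite /lfun_exp dE linear_sum.
apply: eq_bigr => k _; rewrite linearZ /=; congr (_ *: _).
elim: {k}(k : nat) => [|k IHk]; first exact: endomx1.
by rewrite /= endomx_comp // IHk exprSr.
Qed.

(** * The group action and reduced points *)

Section Orbits.

Variables (F : fieldType) (L : lieAlgType F) (E : vectType F).
Variables (n : nat) (e : n.-tuple E) (T : {linear L -> 'End(E)}).
Hypothesis char0 : [pchar F] =i pred0.
Hypothesis e_basis : basis_of fullv e.
Hypothesis T_rep : is_lie_representation T.
Hypothesis T_triangular : strictly_triangular e T.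

Lemma lfun_expNK l x : lfun_exp (T (- l)) (lfun_exp (T l) x) = x.
Proof.
(* [mxexp] takes matrices of positive size, so the trivial space is treated apart. *)
case: n e e_basis T_triangular => [|d] f f_basis tri.
  by apply: (coord_inj f_basis) => -[].
rewrite -comp_lfunE (_ : _ \o _ = \1)%VF ?lfunE //.
apply: (endomx_inj f_basis); rewrite (endomx_comp f_basis).
rewrite !endomx_lfun_exp // (endomx1 f_basis).
rewrite !linearN -{1}[endomx f (T l)]opprK /=.
exact/(mxexpNK char0)/subdiagN/subdiag_endomx.
Qed.

Lemma lfun_exp_comp l m :
  exists k, lfun_exp (T k) = (lfun_exp (T l) \o lfun_exp (T m))%VF.
Proof.
case: n e e_basis T_triangular => [|d] f f_basis tri.
  by exists 0; apply/lfunP => x; apply: (coord_inj f_basis) => -[].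
pose N A := exists k, A = endomx f (T k).
(* [endomx] reverses composition: hence [m] before [l] here, and [lie k' k] for the commutator
   below. *)
have [|||||||_ [k ->] kE] := @mxexp_mul_closed F d char0 N _ _ _ _ _
  (endomx f (T m)) (endomx f (T l)).
- by move=> _ _ [k ->] [k' ->]; exists (k + k'); rewrite !linearD.
- by move=> c _ [k ->]; exists (c *: k); rewrite !linearZ.
- move=> _ _ [k ->] [k' ->]; exists (lie k' k).
  by rewrite T_rep linearB /= !endomx_comp.
- by move=> _ [k ->]; apply: subdiag_endomx.
- by exists 0; rewrite !linear0.
- by exists m.
- by exists l.
exists k; apply: (endomx_inj f_basis).
by rewrite endomx_comp // !endomx_lfun_exp.
Qed.

Lemma Gamma_orbit_sym x y : Gamma_orbit T x y -> Gamma_orbit T y x.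
Proof.
move=> [_ [l ->] ->]; exists (lfun_exp (T (- l))); first by exists (- l).
by rewrite lfun_expNK.
Qed.

Lemma Gamma_orbit_trans x y z :
  Gamma_orbit T x y -> Gamma_orbit T y z -> Gamma_orbit T x z.
Proof.
move=> [_ [l ->] ->] [_ [m ->] ->]; have [k kE] := lfun_exp_comp m l.
by exists (lfun_exp (T k)); [exists k|rewrite kE comp_lfunE].
Qed.

Lemma Gamma_orbit_refl x : Gamma_orbit T x x.
Proof.
(* Going to any orbit point and back avoids evaluating the exponential of 0. *)
have xy : Gamma_orbit T x (lfun_exp (T 0) x).
  by exists (lfun_exp (T 0)) => //; exists 0.
exact: Gamma_orbit_trans xy (Gamma_orbit_sym xy).
Qed.

(** Membership in E_j, the span of the basis vectors of index at least [j]. *)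
Definition vanish_below (j : nat) (x : E) : Prop :=
  forall i : 'I_n, (i < j)%N -> coord e i x = 0.

Lemma vanish_belowD j x y :
  vanish_below j x -> vanish_below j y -> vanish_below j (x + y).
Proof. by move=> hx hy i ij; rewrite linearD /= hx ?hy ?addr0. Qed.

Lemma vanish_belowZ j c x : vanish_below j x -> vanish_below j (c *: x).
Proof. by move=> hx i ij; rewrite linearZ /= hx ?mulr0. Qed.

Lemma vanish_below_leq j k x :
  (k <= j)%N -> vanish_below j x -> vanish_below k x.
Proof. by move=> kj hx i ik; apply/hx/(leq_trans ik). Qed.

Lemma vanish_belowB_coord j x y (i : 'I_n) :
  vanish_below j (x - y) -> (i < j)%N -> coord e i x = coord e i y.
Proof. by move=> h /h /eqP; rewrite linearB subr_eq0 => /eqP. Qed.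

Lemma vanish_below_triangular j u x : strictly_lower_triangular e u ->
  vanish_below j x -> vanish_below j.+1 (u x).
Proof.
move=> hu hx i ij; rewrite (coord_basis e_basis (memvf x)) !linear_sum /=.
apply: big1 => k _; rewrite !linearZ /=; apply/eqP; rewrite mulf_eq0.
have [/hx ->|jk] := ltnP k j; first by rewrite eqxx.
apply/orP; right; apply: contraTT jk => /hu ki; rewrite -ltnNge.
exact: leq_trans ki _.
Qed.

(** The terms of degree at least 2 apply [u] again to [u x], hence lie in E_(j+1). *)
Lemma lfun_exp_vanish_below j u x : strictly_lower_triangular e u ->
  vanish_below j (u x) -> vanish_below j.+1 (lfun_exp u x - x - u x).
Proof.
move=> hu hx.
(* With [n.+2] terms, those of degree 0 and 1 can be split off whatever [n] is. *)
rewrite (lfun_exp_strictly_lower_triangular (N := n.+2) e_basis hu); last first.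
  by rewrite -addn2 leq_addr.
rewrite sum_lfunE !big_ord_recl /= !scale_lfunE comp_lfunE !id_lfunE.
rewrite fact0 invr1 !scale1r [x + _]addrC addrK [u x + _]addrC addrK.
have h k : vanish_below j.+1 (lfun_pow u k.+2 x).
  elim: k => [|k IHk].
    by rewrite /= !comp_lfunE id_lfunE; apply: vanish_below_triangular.
  rewrite [lfun_pow u k.+3](_ : _ = u \o lfun_pow u k.+2)%VF // comp_lfunE.
  exact/(vanish_below_leq (leqnSn _))/vanish_below_triangular.
move=> i ij; rewrite linear_sum big1 // => k _; rewrite scale_lfunE.
exact: vanish_belowZ (h k) _ ij.
Qed.

(** Once [u x] is in E_k with k < j, its coordinate k equals that of [lfun_exp u x - x], which is
    0. *)
Lemma vanish_below_lfun_exp j u x : strictly_lower_triangular e u ->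
  vanish_below j (lfun_exp u x - x) -> vanish_below j (u x).
Proof.
move=> hu hx; suff h k : (k <= j)%N -> vanish_below k (u x) by exact: h.
elim: k => [//|k IHk] kj.
have hk := lfun_exp_vanish_below hu (IHk (ltnW kj)).
move=> i ik; have := hk i ik; rewrite linearB /= hx; last exact: leq_trans kj.
by rewrite sub0r => /eqP; rewrite oppr_eq0 => /eqP.
Qed.

(* Coordinate j of x is as low as the elements l fixing x modulo the span of the
   e_i with i >= j can make it: they move it by the linear form
   l |-> coord e j (T l x). *)
Definition reduced_at (j : 'I_n) (x : E) : Prop :=
  forall l, vanish_below j (T l x) -> coord e j (T l x) != 0 -> coord e j x = 0.

(** At the first coordinate j where y differs from x, the difference is that of [T l x], so
    reducedness gives x_j = 0 and y_j nonzero. *)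
Lemma reduced_prec x y : (forall j, reduced_at j x) ->
  Gamma_orbit T x y -> y <> x -> prec e x y.
Proof.
move=> red [_ [l ->] yE] yx; set v := y - x.
have [j0 vj0] : exists j, coord e j v != 0.
  apply: NNPP => nex; apply/yx/(coord_inj e_basis) => i; apply/eqP.
  by rewrite -subr_eq0 -linearB; apply/negPn/negP => h; apply: nex; exists i.
case: (@arg_minnP _ j0 (fun j => coord e j v != 0)
         (fun j : 'I_n => j : nat) vj0) => j vj jmin {j0 vj0}.
have hv : vanish_below j v.
  by move=> i ij; apply/eqP; apply: contraTT ij => /jmin; rewrite -leqNgt.
have hl : vanish_below j (T l x).
  by apply: vanish_below_lfun_exp => //; rewrite -yE.
have lj : coord e j (T l x) = coord e j v.
  have hj : vanish_below j.+1 (v - T l x).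
    by rewrite /v yE; apply: lfun_exp_vanish_below.
  by rewrite (vanish_belowB_coord hj).
have xj : coord e j x = 0 by apply: (red j l) => //; rewrite lj.
have eqxy (i : 'I_n) : (i < j)%N -> coord e i y = coord e i x.
  exact: vanish_belowB_coord.
have yj : coord e j y != 0 by move: vj; rewrite linearB /= xj subr0.
(* A coordinate k with x_k nonzero and y_k = 0 cannot precede j, so j is the witness. Conversely, no
   index up to j can witness [preceq e y x]. *)
split=> [k xk yk|].
  exists j; split => //; rewrite leqNgt; apply/negP => /eqxy kE.
  by move: xk; rewrite -kE yk eqxx.
case/(_ j yj xj) => i [ij yi0 xi0]; move: ij; rewrite leq_eqVlt.
case/predU1P => [/val_inj ij|/eqxy ij]; first by rewrite ij xj eqxx in xi0.
by rewrite -ij yi0 eqxx in xi0.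
Qed.

Lemma exists_reduced z m :
  exists2 x, Gamma_orbit T z x & forall j : 'I_n, (j < m)%N -> reduced_at j x.
Proof.
elim: m => [|m [x zx red]]; first by exists z => //; apply: Gamma_orbit_refl.
have [nm|mn] := leqP n m.
  by exists x => // j _; apply/red/(leq_trans (ltn_ord j)).
pose j := Ordinal mn.
(* Reducedness quantifies over all of L, so the case split is classical. *)
have [redj|nred] := classic (reduced_at j x).
  exists x => // i; rewrite ltnS leq_eqVlt => /predU1P[im|/red//].
  by rewrite (_ : i = j) //; apply: val_inj.
have [l hlj] := not_all_ex_not _ _ nred.
have [hl hlj'] := imply_to_and _ _ hlj; have [lj _] := imply_to_and _ _ hlj'.
(* The scalar makes coordinate j of [T l' x] equal to -x_j, so that y_j = 0. *)
pose l' := (- coord e j x / coord e j (T l x)) *: l.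
have hl' : vanish_below j (T l' x).
  by rewrite linearZ scale_lfunE; apply: vanish_belowZ.
pose y := lfun_exp (T l') x.
have hy : vanish_below j.+1 (y - x - T l' x) by apply: lfun_exp_vanish_below.
have hxy : vanish_below j (y - x).
  rewrite -[y - x](subrK (T l' x)); apply: vanish_belowD => //.
  exact: vanish_below_leq hy.
exists y.
  by apply: Gamma_orbit_trans zx _; exists (lfun_exp (T l')) => //; exists l'.
move=> i; rewrite ltnS leq_eqVlt => /predU1P[im k _ _|im k].
  have -> : i = j by apply: val_inj.
  have := hy j (ltnSn j); rewrite !linearB /= linearZ scale_lfunE linearZ /=.
  by rewrite divfK // opprK subrK.
(* Since y - x lies in E_m, every [T k] takes x and y to vectors equal modulo E_(m+1); the
   coordinates already reduced stay so. *)
have hk : vanish_below m.+1 (T k y - T k x).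
  by rewrite -linearB; apply: vanish_below_triangular.
have eqk (a : 'I_n) : (a <= i)%N -> coord e a (T k y) = coord e a (T k x).
  move=> ai; apply: (vanish_belowB_coord hk).
  by rewrite ltnS (leq_trans ai) // ltnW.
rewrite (vanish_belowB_coord hxy im).
rewrite eqk // => hky; apply: red => // a ai.
by rewrite -eqk ?hky // ltnW.
Qed.

End Orbits.

Theorem theorem1 (F : fieldType) (char0 : [pchar F] =i pred0)
  (L : lieAlgType F) (E : vectType F) (T : {linear L -> 'End(E)})
  (T_rep : is_lie_representation T)
  (n : nat) (e : n.-tuple E) (e_basis : basis_of fullv e)
  (T_triangular : strictly_triangular e T) :
  forall z : E,
    exists! x : E, Gamma_orbit T z x /\
      (forall y : E, Gamma_orbit T x y -> y <> x -> prec e x y).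
Proof.
move=> z.
have [x zx red] := exists_reduced char0 e_basis T_rep T_triangular z n.
have xlow y : Gamma_orbit T x y -> y <> x -> prec e x y.
  by apply: reduced_prec => // j; apply: red.
exists x; split=> // x' [zx' x'low]; apply: NNPP => xx'.
have sym := Gamma_orbit_sym char0 e_basis T_triangular.
have trans := Gamma_orbit_trans char0 e_basis T_rep T_triangular.
have xx'_orbit : Gamma_orbit T x x' := trans _ _ _ (sym _ _ zx) zx'.
have [xx'_le _] := xlow x' xx'_orbit (fun h => xx' (esym h)).
(* Two distinct lowest points would strictly precede each other. *)
by have [_ []] := x'low x (sym _ _ xx'_orbit) xx'.
Qed.
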